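(* Let $q$ be a prime power (of any characteristic) and $n>1$. Let $\omega_1,\dots,\omega_n$ be elements of an algebraic closure of $\mathbb F_q$ (not necessarily distinct) with $x^n-1=\prod_{i=1}^n(x-\omega_i)$. Let $L(x)=\sum_{i=0}^{n-1}a_ix^{q^i}$ be a nonzero $q$-linear polynomial with all $a_i\in\mathbb F_q$, and set $L^*(x)=\sum_{i=0}^{n-1}a_ix^i$. Suppose that, for some $0<r\le n$ (after suitably ordering the $\omega_i$), \[\gcd(L^*(x),x^n-1)=\prod_{i=r+1}^n(x-\omega_i),\] and let $G\in\mathbb F_q[x]$ be any polynomial with \[L^*(x)\equiv G(x)\prod_{i=r+1}^n(x-\omega_i)\pmod{x^n-1}\] (for instance $G=L^*/\gcd(L^*,x^n-1)$). Then $\operatorname{rank}M_L=r$ and $\det M_L^{(r)}=\prod_{j=1}^r\omega_j^{-r}G(\omega_j)$. In particular, if $r=n$, then $\det M_L=\prod_{j=1}^nL^*(\omega_j)$.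
   Context: For $L(x)=\sum_{i=0}^{n-1}a_ix^{q^i}$, $M_L$ is the $n\times n$ matrix whose $(i,j)$ entry is $a_{(j-i)\bmod n}^{q^{i-1}}$; when all $a_i\in\mathbb F_q$ this is the circulant matrix with first row $a_0,a_1,\dots,a_{n-1}$, each subsequent row being the previous one shifted cyclically one place to the right. $M^{(k)}$ denotes the submatrix of $M$ formed by its first $k$ rows and first $k$ columns. *)

(* Defs.v *)
From HB Require Import structures.
From mathcomp Require Export all_boot all_order all_algebra all_field.

Set Implicit Arguments.
Unset Strict Implicit.
Unset Printing Implicit Defensive.

Import GRing.Theory.
Local Open Scope ring_scope.

Definition qlin_poly (R : nzRingType) (q n : nat) (a : 'I_n -> R) : {poly R} :=
  \sum_(i < n) a i *: 'X^(q ^ i).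

Definition assoc_poly (R : nzRingType) (n : nat) (a : 'I_n -> R) : {poly R} :=
  \sum_(i < n) a i *: 'X^i.

(* (j - i) mod n; n is added before the truncated subtraction. *)
Definition ord_sub_mod (n : nat) (j i : 'I_n) : 'I_n :=
  Ordinal (ltn_pmod (j + n - i)%N (leq_ltn_trans (leq0n i) (ltn_ord i))).

(* Rows are numbered from 0, so the 1-based exponent q^(i-1) becomes q^i. *)
Definition dickson_mx (R : nzRingType) (q n : nat) (a : 'I_n -> R) : 'M[R]_n :=
  \matrix_(i < n, j < n) a (ord_sub_mod j i) ^+ (q ^ i).

Definition leading_submx (R : Type) (n k : nat) (le_kn : (k <= n)%N)
    (M : 'M[R]_n) : 'M[R]_k :=
  mxsub (widen_ord le_kn) (widen_ord le_kn) M.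

(* Main.v *)
(** Write [x^n - 1 = P Q] with [P = prod_(j < r) (x - w_j)] and
    [Q = prod_(i >= r) (x - w_i)].  Row [i] of the circulant matrix lists the
    coefficients of [x^i L* mod (x^n - 1) = Q (x^i G mod P)], so [M = C T], where
    row [i] of [C] is [x^i G mod P] and row [k] of [T] is [x^k Q].  This gives
    [rank M <= r].  The leading [r]-minor of [M] is [det C^(r) det T^(r)]:
    [T^(r)] is upper triangular with constant diagonal [Q(0)], and
    [Q(0) P(0) = -1] makes [Q(0)^r] equal to [prod_(j < r) w_j^(-r)]; [C^(r)] is
    the matrix of multiplication by [G] on [K[x]/(P)], so its determinant is the
    resultant [prod_(j < r) G(w_j)].  The latter is nonzero because
    [gcd (G Q, P Q) = Q] forces [G] and [P] to be coprime. *)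

Require Import Defs.
From HB Require Import structures.
From mathcomp Require Import all_boot all_order all_algebra all_field.

Set Implicit Arguments.
Unset Strict Implicit.

Import GRing.Theory.
Local Open Scope ring_scope.

(** * Multiplication modulo a monic polynomial, as a matrix *)

Lemma linear_poly_mulmx (R : nzRingType) m r (f : {poly R} -> 'rV[R]_m)
    (p : {poly R}) :
  linear f -> (size p <= r)%N ->
  f p = poly_rV p *m \matrix_(k < r) f 'X^k.
Proof.
move=> f_lin le_pr.
pose g : {linear {poly R} -> 'rV[R]_m} :=
  HB.pack f (GRing.isLinear.Build _ _ _ _ f f_lin).
rewrite -[f]/(g : _ -> _) -[in LHS](poly_rV_K le_pr) [rVpoly _]poly_def.
rewrite linear_sum mulmx_sum_row; apply: eq_bigr => k _.
by rewrite linearZ rowK /= valK.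
Qed.

Section MulModMatrix.

Variable F : fieldType.
Implicit Types p P G H : {poly F}.

(** For [P] of degree [r], this is multiplication by [G] on [F[X]/(P)] in the basis
    [1, X, ..., X^(r-1)], acting on row vectors. *)
Definition mulmod_mx r P G : 'M[F]_r :=
  \matrix_(i < r) poly_rV (('X^i * G) %% P).

Lemma mulmod_mxE r P G p : (size p <= r)%N ->
  poly_rV ((p * G) %% P) = poly_rV p *m mulmod_mx r P G.
Proof.
apply: (@linear_poly_mulmx _ _ _ (fun p => poly_rV ((p * G) %% P))) => c u v.
by rewrite mulrDl -scalerAl modpD modpZl linearP.
Qed.

Section MonicModulus.

Variables (r : nat) (P : {poly F}).
Hypotheses (monP : P \is monic) (szP : size P = r.+1).

Let P_neq0 : P != 0. Proof. exact: monic_neq0. Qed.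

Lemma mulmod_mxM G H : mulmod_mx r P (G * H) = mulmod_mx r P G *m mulmod_mx r P H.
Proof.
apply/row_matrixP => i; rewrite row_mul !rowK -mulmod_mxE.
  by rewrite [_ %% P * H]mulrC modp_mul mulrA mulrC.
by rewrite -ltnS -szP ltn_modp.
Qed.

Lemma mulmod_mxC c : mulmod_mx r P c%:P = c%:M.
Proof.
apply/row_matrixP => i; rewrite rowK -scalemx1 linearZ /= row1 mulrC mul_polyC.
rewrite modp_small; last first.
  by rewrite (leq_ltn_trans (size_scale_leq _ _)) // size_polyXn szP ltnS.
by rewrite linearZ /= -rVpoly_delta rVpolyK.
Qed.

Lemma mulmod_mxB G H : mulmod_mx r P (G - H) = mulmod_mx r P G - mulmod_mx r P H.
Proof.
by apply/row_matrixP => i; rewrite linearB /= !rowK mulrBr modpD modpN linearB.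
Qed.

(** Multiplication by [X] modulo [P] is given by the companion matrix of [P]. *)
Lemma char_poly_mulmod_mxX : char_poly (mulmod_mx r P 'X) = P.
Proof.
have Er : r = (size P).-1 by rewrite szP.
rewrite -[RHS](companionmxK monP); move: szP; rewrite {}Er => szP'.
congr char_poly; apply/matrixP => i j; rewrite !mxE -exprSr.
have lti := ltn_ord i; have ltj := ltn_ord j.
case: eqP => [Ei | /eqP neqi].
  have -> : i.+1 = (size P).-1 by rewrite Ei prednK // (leq_trans _ lti).
  (* In the last row [X^r = 1 * P + (X^r - P)]; since [P] is monic, the leading terms cancel and
     [X^r - P] is the remainder. *)
  rewrite -(modpP (q := 1) (r := 'X^((size P).-1) - P)).
  - by rewrite coefB coefXn ltn_eqF // sub0r.
  - by rewrite mul1r addrC subrK.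
  - rewrite [X in (_ < X)%N]szP' ltnS; apply/leq_sizeP => k.
    rewrite leq_eqVlt => /predU1P[<- | ltk]; rewrite coefB coefXn.
      by rewrite eqxx -lead_coefE (monicP monP) subrr.
    by rewrite gtn_eqF // nth_default ?subrr // szP'.
rewrite modp_small ?coefXn 1?eq_sym // size_polyXn [X in (_ < X)%N]szP' ltnS.
rewrite ltn_neqAle lti andbT; apply: contra neqi => /eqP Ei.
by apply/eqP; rewrite -[LHS]/(i.+1.-1) Ei.
Qed.

(** With [N] the matrix of [X], [P.[c] = det (c - N)]; passing to [N - c] costs one sign per row. *)
Lemma det_mulmod_mx_XsubC c : \det (mulmod_mx r P ('X - c%:P)) = (-1) ^+ r * P.[c].
Proof.
rewrite mulmod_mxB mulmod_mxC -[X in _ * X.[_]]char_poly_mulmod_mxX.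
rewrite -[_.[c]]/(horner_eval c _) /char_poly -det_map_mx -detZ; congr (\det _).
apply/matrixP => i j; rewrite !mxE /= /horner_eval.
by rewrite hornerD hornerN hornerMn hornerX hornerC mulN1r opprB.
Qed.

End MonicModulus.
End MulModMatrix.

Arguments mulmod_mx {F} r P G.

(* Factoring [G] over the closed field reduces to [G = x - c], where the
   determinant is, up to sign, the characteristic polynomial of the companion
   matrix at [c].  This also covers repeated roots [v j], for which a Vandermonde
   argument would fail. *)
Lemma det_mulmod_mx (K : closedFieldType) r (v : 'I_r -> K) (G : {poly K}) :
  \det (mulmod_mx r (\prod_(j < r) ('X - (v j)%:P)) G) = \prod_(j < r) G.[v j].
Proof.
set P := \prod_(j < r) _.
have monP : P \is monic by exact: monic_prod_XsubC.
have szP : size P = r.+1.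
  by rewrite size_prod_XsubC /index_enum -enumT size_enum_ord.
have [s ->] := closed_field_poly_normal G.
elim/big_rec: _ => [|c H _ IH].
  rewrite -[1]/(1%:P) scale_polyC mulr1 mulmod_mxC // det_scalar.
  by under eq_bigr do rewrite hornerC; rewrite prodr_const card_ord.
rewrite scalerAr mulmod_mxM // det_mulmx IH det_mulmod_mx_XsubC // horner_prod.
under eq_bigr do rewrite hornerXsubC -opprB.
rewrite prodrN card_ord mulrA -exprD -signr_odd addnn odd_double mul1r.
rewrite -big_split.
by apply: eq_bigr => j _; rewrite !hornerE.
Qed.

(** * Circulants and reduction modulo [X^n - 1] *)

Lemma modp_XnsubC1 (F : fieldType) n m : (0 < n)%N ->
  'X^m %% ('X^n - 1) = 'X^(m %% n) :> {poly F}.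
Proof.
move=> n_gt0; have szn : size ('X^n - 1 : {poly F}) = n.+1 by rewrite size_XnsubC.
rewrite {1}(divn_eq m n) addnC exprD mulnC exprM.
set y : {poly F} := 'X^n.
(* [y - 1] divides [y^k - 1], so [y^k] reduces to [1]. *)
have -> : y ^+ (m %/ n) = (y ^+ (m %/ n) - 1) + 1 by rewrite subrK.
rewrite mulrDr mulr1 modpD subrX1 mulrCA modp_mulr add0r.
by rewrite modp_small // size_polyXn szn ltnS ltn_pmod.
Qed.

(** Multiplying by [X^i] modulo [X^n - 1] shifts the coefficients cyclically by [i] places. *)
Lemma row_circulant (F : fieldType) n (b : 'I_n -> F) (i : 'I_n) :
  row i (\matrix_(i, j) b (ord_sub_mod j i)) =
  poly_rV (('X^i * assoc_poly b) %% ('X^n - 1)).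
Proof.
have n_gt0 : (0 < n)%N by case: (n) i => // [[]].
have -> : ('X^i * assoc_poly b) %% ('X^n - 1) =
          \sum_(k < n) b k *: 'X^((i + k) %% n)%N.
  rewrite mulr_sumr (big_morph (fun p => p %% _) (modpD _) (mod0p _)).
  by apply: eq_bigr => k _; rewrite -scalerAr modpZl -exprD modp_XnsubC1.
apply/rowP => j; rewrite !mxE coef_sumMXn.
rewrite (big_pred1 (ord_sub_mod j i)) // => k /=.
have [lti ltj] := (ltn_ord i, ltn_ord j); have ltk := ltn_ord k.
rewrite -[RHS]val_eqE /= -{2}(modn_small ltk) -(eqn_modDl i).
by rewrite subnKC ?modnDr ?(modn_small ltj) // ltnW ?ltn_addl.
Qed.

Lemma modp_mul2l (F : fieldType) (p q d : {poly F}) :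
  d != 0 -> q != 0 -> (q * p) %% (q * d) = q * (p %% d).
Proof.
move=> d_neq0 q_neq0; apply/esym/(@modpP _ _ (p %/ d)).
  by rewrite mulrCA -mulrDr -divp_eq.
have [->|m_neq0] := eqVneq (p %% d) 0.
  by rewrite mulr0 size_poly0 size_poly_gt0 mulf_neq0.
rewrite !size_mul //; have := ltn_modp p d; rewrite d_neq0.
move: q_neq0; rewrite -size_poly_gt0; case: (size q) => // k _.
by rewrite !addSn ltn_add2l.
Qed.

Lemma mxrank_mxsub_le (F : fieldType) m n m' n' (f : 'I_m' -> 'I_m)
    (g : 'I_n' -> 'I_n) (A : 'M[F]_(m, n)) :
  (\rank (mxsub f g A) <= \rank A)%N.
Proof.
rewrite -[A]mulmx1 mxsub_mul (leq_trans (mxrankM_maxl _ _)) //.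
by rewrite rowsubE mulmx1 mxrankM_maxr.
Qed.

Lemma coef0_prod_XsubC_cond (R : comNzRingType) (I : finType) (A : pred I)
    (w : I -> R) :
  (\prod_(i | A i) ('X - (w i)%:P))`_0 = \prod_(i | A i) - w i.
Proof.
rewrite -horner_coef0 horner_prod; apply: eq_bigr => i _.
by rewrite hornerXsubC sub0r.
Qed.

Lemma prod_XsubC_split (R : comNzRingType) n r (le_rn : (r <= n)%N)
    (w : 'I_n -> R) :
  \prod_(i < n) ('X - (w i)%:P) =
  \prod_(i < n | (r <= i)%N) ('X - (w i)%:P) *
  \prod_(j < r) ('X - (w (widen_ord le_rn j))%:P).
Proof.
rewrite (bigID (fun i : 'I_n => (i < r)%N)) /= (big_ord_narrow le_rn) mulrC.
by congr (_ * _); apply: eq_bigl => i; rewrite -leqNgt.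
Qed.

Lemma root_of_unity_prod (R : comNzRingType) n (w : 'I_n -> R) :
  'X^n - 1 = \prod_(i < n) ('X - (w i)%:P) -> forall i, w i ^+ n = 1.
Proof.
move=> w_roots i; apply/eqP; rewrite -subr_eq0.
have := congr1 (horner^~ (w i)) w_roots.
rewrite horner_prod (bigD1 i) //= hornerXsubC subrr mul0r => <-.
by rewrite hornerD hornerN hornerXn hornerC.
Qed.

(** * Factorization, leading minor and rank of the circulant *)

Section Circulant.

Variables (K : closedFieldType) (n r : nat) (le_rn : (r <= n)%N).
Variable w : 'I_n -> K.
Hypothesis r_gt0 : (0 < r)%N.
Hypothesis w_roots : 'X^n - 1 = \prod_(i < n) ('X - (w i)%:P).
Let P : {poly K} := \prod_(j < r) ('X - (w (widen_ord le_rn j))%:P).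
Let Q : {poly K} := \prod_(i < n | (r <= i)%N) ('X - (w i)%:P).
Variables (b : 'I_n -> K) (G : {poly K}).
Hypothesis congG : 'X^n - 1 %| assoc_poly b - G * Q.
Let M : 'M[K]_n := \matrix_(i, j) b (ord_sub_mod j i).

Let PQ : 'X^n - 1 = Q * P.
Proof. by rewrite w_roots; apply: prod_XsubC_split. Qed.

Let n_gt0 : (0 < n)%N. Proof. exact: leq_trans le_rn. Qed.
Let monP : P \is monic. Proof. exact: monic_prod_XsubC. Qed.
Let monQ : Q \is monic. Proof. exact: monic_prod_XsubC. Qed.

Let szP : size P = r.+1.
Proof. by rewrite size_prod_XsubC /index_enum -enumT size_enum_ord. Qed.

Let root_P j : root P (w (widen_ord le_rn j)).
Proof. by rewrite rootE horner_prod (bigD1 j) //= hornerXsubC subrr mul0r. Qed.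

Let w_neq0 i : w i != 0.
Proof.
apply/eqP => w0; have := root_of_unity_prod w_roots i; rewrite w0 expr0n gtn_eqF //.
by move/eqP; rewrite eq_sym oner_eq0.
Qed.

Let C : 'M[K]_(n, r) := \matrix_(i < n) poly_rV (('X^i * G) %% P).
Let T : 'M[K]_(r, n) := \matrix_(k < r) poly_rV ('X^k * Q).

Lemma circulant_factorization : M = C *m T.
Proof.
apply/row_matrixP => i; rewrite row_circulant row_mul rowK.
have -> : 'X^i * assoc_poly b =
          'X^i * (assoc_poly b - G * Q) + Q * ('X^i * G).
  by rewrite mulrBr [Q * _]mulrC -!mulrA subrK.
have /eqP := dvdp_mull 'X^i congG; rewrite -/(_ %| _) modpD => ->.
(* [Q] comes out of the reduction modulo [Q * P]; expanding [X^i * G %% P] in monomials then gives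
   row [i] of [C] times [T]. *)
rewrite add0r PQ modp_mul2l ?monic_neq0 // mulrC.
apply: (@linear_poly_mulmx _ _ _ (fun p => poly_rV (p * Q))) => [c u v|].
  by rewrite mulrDl -scalerAl linearP.
by rewrite -ltnS -szP ltn_modp monic_neq0.
Qed.

Lemma mxrank_circulant_le : (\rank M <= r)%N.
Proof.
by rewrite circulant_factorization (leq_trans (mxrankM_maxl _ _)) ?rank_leq_col.
Qed.

Let Q0_exp : Q`_0 ^+ r = \prod_(j < r) w (widen_ord le_rn j) ^- r.
Proof.
have := congr1 (fun p : {poly K} => p`_0) PQ.
rewrite coefB coefXn coef1 eqxx (ltn_eqF n_gt0) sub0r coef0M.
rewrite [P`_0]coef0_prod_XsubC_cond prodrN card_ord.
rewrite mulr1n; set W := (X in _ * (_ * X)) => Q0W.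
have W_neq0 : W != 0 by apply/prodf_neq0 => j _; apply: w_neq0.
have -> : Q`_0 = (-1) ^+ r.+1 * W^-1.
  apply: (mulIf W_neq0); rewrite mulfVK // exprS {1}Q0W [_ ^+ r * W]mulrC.
  by rewrite -!mulrA -exprD addnn -signr_odd odd_double mulr1.
(* The sign is [(-1)^((r+1) r)], an even power. *)
rewrite exprMn -exprM -signr_odd oddM /= andNb mul1r.
by rewrite /W -prodfV -prodrXl; apply: eq_bigr => j _; rewrite exprVn.
Qed.

Lemma det_leading_circulant :
  \det (leading_submx le_rn M) =
  \prod_(j < r) (w (widen_ord le_rn j) ^- r * G.[w (widen_ord le_rn j)]).
Proof.
rewrite /leading_submx circulant_factorization mxsub_mul det_mulmx.
have -> : rowsub (widen_ord le_rn) C = mulmod_mx r P G.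
  by apply/matrixP => i j; rewrite !mxE.
rewrite det_mulmod_mx big_split mulrC -Q0_exp; congr (_ * _).
(* [X^k * Q] has no coefficient below degree [k] and has [Q(0)] in degree [k]; the transpose makes
   the block lower triangular. *)
rewrite -det_tr det_trig; last first.
  by apply/is_trig_mxP => i j lt_ij; rewrite !mxE coefXnM /= lt_ij.
rewrite -[r in RHS]card_ord -prodr_const; apply: eq_bigr => i _.
by rewrite !mxE coefXnM /= ltnn subnn.
Qed.

(** Coprimality keeps [G] from vanishing at the roots of [P], so the leading block is invertible and
    bounds the rank from below. *)
Lemma mxrank_circulant : coprimep G P -> \rank M = r.
Proof.
move=> copGP; apply/eqP; rewrite eqn_leq mxrank_circulant_le /=.
have unitM : leading_submx le_rn M \in unitmx.
  rewrite unitmxE det_leading_circulant unitfE; apply/prodf_neq0 => j _.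
  rewrite mulf_neq0 ?invr_neq0 ?expf_neq0 //.
  by apply: coprimep_root (root_P j); rewrite coprimep_sym.
by rewrite -{1}(mxrank_unit unitM) mxrank_mxsub_le.
Qed.

End Circulant.

Unset Implicit Arguments.
Set Strict Implicit.

Theorem theorem3p3
  (q n : nat) (F : finFieldType) (cardF : #|F| = q) (n_gt1 : (1 < n)%N)
  (K : closedFieldType) (iota : {rmorphism F -> K})
  (algK : integralRange iota)
  (w : 'I_n -> K) (w_roots : 'X^n - 1 = \prod_(i < n) ('X - (w i)%:P))
  (a : 'I_n -> F) (L_neq0 : qlin_poly q a != 0)
  (r : nat) (r_gt0 : (0 < r)%N) (le_rn : (r <= n)%N)
  (gcdL : map_poly iota (gcdp (assoc_poly a) ('X^n - 1)) %=
            \prod_(i < n | (r <= i)%N) ('X - (w i)%:P))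
  (G : {poly F})
  (congG : 'X^n - 1 %| map_poly iota (assoc_poly a) -
             map_poly iota G * \prod_(i < n | (r <= i)%N) ('X - (w i)%:P)) :
  [/\ \rank (dickson_mx q a) = r,
      iota (\det (leading_submx le_rn (dickson_mx q a))) =
        \prod_(j < n | (j < r)%N) (w j ^- r * (map_poly iota G).[w j])
    & r = n ->
      iota (\det (dickson_mx q a)) =
        \prod_(j < n) (map_poly iota (assoc_poly a)).[w j]].
Proof.
pose b i := iota (a i).
have Lb : map_poly iota (assoc_poly a) = assoc_poly b.
  by rewrite rmorph_sum; apply: eq_bigr => i _; rewrite /= map_polyZ map_polyXn.
(* Elements of [F] are fixed by the [q]-power map, so the Dickson matrix is a circulant. *)
have frob (x : F) k : x ^+ (q ^ k) = x.
  by elim: k => // k IHk; rewrite expnS exprM -cardF expf_card cardF.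
pose M := \matrix_(i, j) b (ord_sub_mod j i).
have mapM : map_mx iota (dickson_mx q a) = M.
  by apply/matrixP => i j; rewrite !mxE frob.
rewrite Lb in congG *.
have detM : iota (\det (leading_submx le_rn (dickson_mx q a))) =
    \prod_(j < n | (j < r)%N) (w j ^- r * (map_poly iota G).[w j]).
  rewrite -det_map_mx map_mxsub mapM (big_ord_narrow le_rn).
  exact: det_leading_circulant congG.
split => //.
- rewrite -(mxrank_map iota) mapM.
  apply: (mxrank_circulant r_gt0 w_roots congG).
  set P := \prod_(j < r) _; set Q := \prod_(i < n | (r <= i)%N) _ in gcdL congG.
  have Q_neq0 : Q != 0 by rewrite monic_neq0 // monic_prod_XsubC.
  have PQ : 'X^n - 1 = Q * P by rewrite w_roots; apply: prod_XsubC_split.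
  have /dvdpP[c defb] := congG.
  rewrite gcdp_map rmorphB /= map_polyXn rmorph1 Lb in gcdL.
  have {}defb : assoc_poly b = c * ('X^n - 1) + map_poly iota G * Q.
    by rewrite -defb subrK.
  (* Multiplied by [Q], coprimality reads [gcd (G Q, X^n - 1) = Q] up to a unit; [G Q] and [L*]
     differ by a multiple of [X^n - 1]. *)
  rewrite -gcdp_eqp1 -(eqp_mul2r _ _ Q_neq0) mul1r -(eqp_rtrans gcdL) defb.
  rewrite -(eqp_ltrans (gcdp_mul2r _ _ _)) [P * Q]mulrC -PQ.
  rewrite (eqp_ltrans (gcdpC _ _)) (eqp_rtrans (gcdpC _ _)) eqp_sym.
  exact: gcdp_addl_mul.
- move=> Ern; subst r; move: detM.
  have -> : leading_submx le_rn (dickson_mx q a) = dickson_mx q a.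
    apply/matrixP => i j; rewrite [LHS]mxE.
    by congr (dickson_mx q a _ _); apply: val_inj.
  move=> ->; apply: eq_big => [j | j _]; first exact: ltn_ord.
  (* [w_j^n = 1] removes the factor [w_j^(-n)]. [Q] is now an empty product, so the congruence
     evaluated at [w_j] gives [G(w_j) = L*(w_j)]. *)
  rewrite (root_of_unity_prod w_roots) invr1 mul1r; apply/esym/eqP.
  have /dvdpP[c] := congG; rewrite big_pred0 => [|i]; last first.
    by rewrite leqNgt ltn_ord.
  move/(congr1 (horner^~ (w j))); rewrite mulr1 !hornerE.
  by rewrite (root_of_unity_prod w_roots) subrr mulr0 => /eqP; rewrite subr_eq0.
Qed.
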